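(* Let $\mathsf{O}_s$ be the category of semi-closed operads and closed functors, and let $\mathsf{T}_s$ be the category of $s$-triples and their morphisms. There is an adjunction $L \dashv R$ with left adjoint $L : \mathsf{O}_s \to \mathsf{T}_s$ and right adjoint $R : \mathsf{T}_s \to \mathsf{O}_s$ (where $L$ and $R$ are the functors described in the context). Moreover, the unit of this adjunction is an isomorphism, witnessing $\mathsf{O}_s$ as a full subcategory of $\mathsf{T}_s$.
   Context: **Multicategories.** A multicategory $\mathcal{M}$ (planar, i.e. with no symmetric group actions) has a set $\mathcal{M}_0$ of objects, sets $\mathcal{M}(A_1,\ldots,A_n;B)$ of morphisms for all $n\ge 0$, associative composition $f\circ(g_1,\ldots,g_n)$, and unital identities $1_A\in\mathcal{M}(A;A)$. $A^n$ is the sequence of $n$ copies of $A$; the domain may be empty, as in $\mathcal{M}(;A)$; we write $f\circ g$ for $f\circ(g)$. A functor $F:\mathcal{M}\to\mathcal{N}$ maps objects to objects and $\mathcal{M}(A_1,\ldots,A_n;B)$ to $\mathcal{N}(FA_1,\ldots,FA_n;FB)$, preserving composition and identities. An operad is a multicategory with exactly one object, denoted $*$; write $\mathcal{M}(n)=\mathcal{M}( *^n;* )$. **Semi-closed multicategory.** A multicategory $\mathcal{M}$ together with an object $[A,B]$ and a morphism $\mathsf{ev}_{A,B}\in\mathcal{M}([A,B],A;B)$ for all $A,B\in\mathcal{M}_0$, such that there exist mappings $\Lambda^\Gamma_{A,B}:\mathcal{M}(\Gamma,A;B)\to\mathcal{M}(\Gamma;[A,B])$ for all finite sequences $\Gamma$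 of objects and all $A,B$ satisfying: $\mathsf{ev}_{A,B}\circ(\Lambda^\Gamma_{A,B}(f),1_A)=f$ for all $f\in\mathcal{M}(\Gamma,A;B)$; and for $\Gamma=A_1,\ldots,A_n$, $g\in\mathcal{M}(\Gamma,A;B)$ and $f_i\in\mathcal{M}(\Gamma_i;A_i)$, $\Lambda^{\Gamma_1,\ldots,\Gamma_n}_{A,B}(g\circ(f_1,\ldots,f_n,1_A))=\Lambda^\Gamma_{A,B}(g)\circ(f_1,\ldots,f_n)$. The mappings $\Lambda$ are required to exist but are not part of the data. In a semi-closed operad necessarily $[*,*]=*$, and $\mathsf{ev}=\mathsf{ev}_{*,*}\in\mathcal{M}(2)$. A functor $F$ between semi-closed multicategories is closed if $F[A,B]=[FA,FB]$ and $F(\mathsf{ev}_{A,B})=\mathsf{ev}_{FA,FB}$ for all $A,B$. **Applicative systems.** An applicative system $(A,\bullet)$ in $\mathcal{M}$ is an object $A$ with a morphism $\bullet\in\mathcal{M}(A,A;A)$. Define $\bullet^n\in\mathcal{M}(A^{n+1};A)$ by $\bullet^0=1_A$, $\bullet^{n+1}=\bullet\circ(\bullet^n,1_A)$. A morphism $f\in\mathcal{M}(A^n;A)$ is $(A,\bullet)$-computable if there is $a\in\mathcal{M}(;A)$ (a representative of $f$) with $\bullet^n\circ(a,1_A,\ldots,1_A)=f$. For $a,b\in\mathcal{M}(;A)$ write $ab=\bullet\circ(a,b)\in\mathcal{M}(;A)$, associating to the left. **Planar combinatory algebra.** An applicative system such that $\bullet\circ(1_A,\bullet)\in\mathcal{M}(A^3;A)$,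 $1_A$, and $\bullet\circ(1_A,a)$ for every $a\in\mathcal{M}(;A)$ are computable. Representatives of these are denoted $\mathsf{B}$, $\mathsf{I}$, $a^\bullet$ respectively (elements of $\mathcal{M}(;A)$). **Planar $\lambda$-algebra.** A planar combinatory algebra such that, for some choice of $\mathsf{B}$, $\mathsf{I}$ and $a^\bullet$, the following hold in $\mathcal{M}(;A)$ for all $a,b\in\mathcal{M}(;A)$: [P.1] $\mathsf{B}(\mathsf{B}(\mathsf{B}\mathsf{I}))\mathsf{B}=\mathsf{B}$; [P.2] $\mathsf{B}\mathsf{I}\mathsf{I}=\mathsf{I}$; [P.3] $\mathsf{B}\mathsf{I}a^\bullet=a^\bullet$; [P.4] $\mathsf{B}\mathsf{B}^\bullet(\mathsf{B}\mathsf{B}(\mathsf{B}\mathsf{B}\mathsf{B}))=\mathsf{B}(\mathsf{B}\mathsf{B})\mathsf{B}$; [P.5] $\mathsf{B}\mathsf{I}^\bullet\mathsf{B}=\mathsf{B}\mathsf{I}$; [P.6] $\mathsf{B}a^{\bullet\bullet}\mathsf{B}=\mathsf{B}(\mathsf{B}a^\bullet)\mathsf{B}$; [P.7] $(ab)^\bullet=\mathsf{B}b^\bullet(\mathsf{B}a^\bullet\mathsf{B})$. Such a choice is fixed whenever one works with a planar $\lambda$-algebra. Put $a*b=\mathsf{B}ab$, $a^{*0}=\mathsf{I}$, $a^{*(n+1)}=a^{*n}*a$. **Planar $\lambda$-model.** A planar $\lambda$-algebra (with such a choice of $\mathsf{B},\mathsf{I},a^\bullet$) that is weakly multi-extensional: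 for all $a,b\in\mathcal{M}(;A)$ and $n\in\mathbb{N}$, if $\bullet^n\circ(a,1_A,\ldots,1_A)=\bullet^n\circ(b,1_A,\ldots,1_A)$ in $\mathcal{M}(A^n;A)$, then $\mathsf{B}^{*n}\mathsf{I}a=\mathsf{B}^{*n}\mathsf{I}b$ in $\mathcal{M}(;A)$. **$s$-triples.** An $s$-triple $(\mathcal{M},A,\bullet)$ is a multicategory $\mathcal{M}$ with a planar $\lambda$-model $(A,\bullet)$ in $\mathcal{M}$. A morphism $(\mathcal{M},A,\bullet)\to(\mathcal{N},B,\odot)$ is a functor $F:\mathcal{M}\to\mathcal{N}$ with $FA=B$ and $F(\bullet)=\odot$. **The functors.** $R$ sends $(\mathcal{M},A,\bullet)$ to the operad $R(\mathcal{M},A,\bullet)$ whose morphisms of arity $n$ are the $(A,\bullet)$-computable morphisms in $\mathcal{M}(A^n;A)$, with composition and identity inherited from $\mathcal{M}$ and with $\mathsf{ev}$ given by $\bullet$. $L$ sends a semi-closed operad $\mathcal{M}$ to $(\mathcal{M},*,\mathsf{ev}_{*,*})$. On morphisms, both act in the evident way ($L(F)=F$, and $R(F)$ is the restriction of $F$ to computable morphisms). *)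

(* Defs.v *)
From Stdlib Require Import FunctionalExtensionality ProofIrrelevance.
From mathcomp Require Import all_boot.

Set Implicit Arguments.
Unset Strict Implicit.
Unset Printing Implicit Defensive.

#[local] Obligation Tactic := idtac.

Record category := Category {
  Ob :> Type;
  Hom : Ob -> Ob -> Type;
  cid : forall X, Hom X X;
  ccomp : forall X Y Z, Hom Y Z -> Hom X Y -> Hom X Z;
  ccomp1f : forall X Y (f : Hom X Y), ccomp (cid Y) f = f;
  ccompf1 : forall X Y (f : Hom X Y), ccomp f (cid X) = f;
  ccompA : forall X Y Z W (h : Hom Z W) (g : Hom Y Z) (f : Hom X Y),
    ccomp h (ccomp g f) = ccomp (ccomp h g) f
}.

Record functor (C D : category) := Functor {
  fob :> C -> D;
  fmap : forall X Y : C, Hom X Y -> Hom (fob X) (fob Y);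
  fmap_id : forall X : C, fmap (cid X) = cid (fob X);
  fmap_comp : forall (X Y Z : C) (g : Hom Y Z) (f : Hom X Y),
    fmap (ccomp g f) = ccomp (fmap g) (fmap f)
}.

Definition is_iso (C : category) (X Y : C) (f : Hom X Y) : Prop :=
  exists g : Hom Y X, ccomp g f = cid X /\ ccomp f g = cid Y.

Definition fully_faithful (C D : category) (F : functor C D) : Prop :=
  forall X Y : C, bijective (@fmap C D F X Y).

Record adjunction (C D : category) (L : functor C D) (R : functor D C) :=
  Adjunction {
  adj_unit : forall X : C, Hom X (R (L X));
  adj_counit : forall Y : D, Hom (L (R Y)) Y;
  adj_unit_nat : forall (X X' : C) (f : Hom X X'),
    ccomp (adj_unit X') f = ccomp (fmap R (fmap L f)) (adj_unit X);
  adj_counit_nat : forall (Y Y' : D) (g : Hom Y Y'),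
    ccomp (adj_counit Y') (fmap L (fmap R g)) = ccomp g (adj_counit Y);
  adj_triangleL : forall X : C,
    ccomp (adj_counit (L X)) (fmap L (adj_unit X)) = cid (L X);
  adj_triangleR : forall Y : D,
    ccomp (fmap R (adj_counit Y)) (adj_unit (R Y)) = cid (R Y)
}.

(* All morphisms live in one type [mor], with domain and codomain maps; the set
   M(G;B) is the fibre [mhom G B] below.  Composition f o (g_1,...,g_n) is
   defined when the codomains of the g_i spell the domain of f; it is
   represented by a total function whose value outside that case is pinned
   down by [comp_out], so that it carries exactly the data of the partial
   operation.  In [compA], the i-th entry of hss is the tuple composed with the
   i-th entry of gs. *)
Record multicategory := Multicategory {
  ob : Type;
  mor : Type;
  dom : mor -> seq ob;
  cod : mor -> ob;
  idm : ob -> mor;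
  comp : mor -> seq mor -> mor;
  dom_id : forall A, dom (idm A) = [:: A];
  cod_id : forall A, cod (idm A) = A;
  dom_comp : forall f gs, map cod gs = dom f ->
    dom (comp f gs) = flatten (map dom gs);
  cod_comp : forall f gs, map cod gs = dom f -> cod (comp f gs) = cod f;
  comp_out : forall f gs, map cod gs <> dom f -> comp f gs = f;
  comp1f : forall f, comp (idm (cod f)) [:: f] = f;
  compf1 : forall f, comp f (map idm (dom f)) = f;
  compA : forall f gs hss,
    map cod gs = dom f -> map (map cod) hss = map dom gs ->
    comp f [seq comp p.1 p.2 | p <- zip gs hss] = comp (comp f gs) (flatten hss)
}.

Arguments dom {m} _.
Arguments cod {m} _.
Arguments idm {m} _.
Arguments comp {m} _ _.

Definition mhom (M : multicategory) (G : seq (ob M)) (B : ob M) (f : mor M) :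
  Prop := dom f = G /\ cod f = B.

Record mfunctor (M N : multicategory) := MFunctor {
  mf_ob : ob M -> ob N;
  mf_mor : mor M -> mor N;
  mf_dom : forall f, dom (mf_mor f) = map mf_ob (dom f);
  mf_cod : forall f, cod (mf_mor f) = mf_ob (cod f);
  mf_id : forall A, mf_mor (idm A) = idm (mf_ob A);
  mf_comp : forall f gs, map cod gs = dom f ->
    mf_mor (comp f gs) = comp (mf_mor f) (map mf_mor gs)
}.

Lemma composable_mf (M N : multicategory) (F : mfunctor M N) f gs :
  map cod gs = dom f -> map cod (map (mf_mor F) gs) = dom (mf_mor F f).
Proof.
by move=> e; rewrite mf_dom -e -!map_comp; apply: eq_map => g /=; rewrite mf_cod.
Qed.

Lemma mfunctor_eq M N (F G : mfunctor M N) :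
  mf_ob F =1 mf_ob G -> mf_mor F =1 mf_mor G -> F = G.
Proof.
case: F G => [o m a b c d] [o' m' a' b' c' d'] /= /functional_extensionality eo.
move=> /functional_extensionality em; subst o' m'.
by congr MFunctor; exact: proof_irrelevance.
Qed.

Program Definition mfunctor_id M : mfunctor M M :=
  @MFunctor M M id id _ _ _ _.
Next Obligation. by move=> M f; rewrite map_id. Qed.
Next Obligation. by []. Qed.
Next Obligation. by []. Qed.
Next Obligation. by move=> M f gs _; rewrite map_id. Qed.

Program Definition mfunctor_comp M N P (G : mfunctor N P) (F : mfunctor M N) :
  mfunctor M P :=
  @MFunctor M P (mf_ob G \o mf_ob F) (mf_mor G \o mf_mor F) _ _ _ _.
Next Obligation. by move=> M N P G F f /=; rewrite !mf_dom map_comp. Qed.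
Next Obligation. by move=> M N P G F f /=; rewrite !mf_cod. Qed.
Next Obligation. by move=> M N P G F A /=; rewrite !mf_id. Qed.
Next Obligation.
move=> M N P G F f gs e /=.
by rewrite (mf_comp F e) (mf_comp G (composable_mf F e)) -map_comp.
Qed.

(* The concatenation G, A of a context and an object is [rcons G A]; values of
   [lam] outside M(G,A;B) are unconstrained. *)
Definition semi_closed (M : multicategory) (ihom : ob M -> ob M -> ob M)
    (ev : ob M -> ob M -> mor M) : Prop :=
  (forall A B, mhom [:: ihom A B; A] B (ev A B)) /\
  exists lam : seq (ob M) -> ob M -> ob M -> mor M -> mor M,
  [/\ forall G A B f, mhom (rcons G A) B f ->
        mhom G (ihom A B) (lam G A B f),
      forall G A B f, mhom (rcons G A) B f ->
        comp (ev A B) [:: lam G A B f; idm A] = f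
    & forall G A B g fs, mhom (rcons G A) B g -> map cod fs = G ->
        lam (flatten (map dom fs)) A B (comp g (rcons fs (idm A)))
          = comp (lam G A B g) fs].

Record semi_closed_multicategory := SemiClosedMulticategory {
  sc_mcat :> multicategory;
  ihom : ob sc_mcat -> ob sc_mcat -> ob sc_mcat;
  ev : ob sc_mcat -> ob sc_mcat -> mor sc_mcat;
  sc_semi_closed : semi_closed ihom ev
}.

Arguments ihom {s} _ _.
Arguments ev {s} _ _.

Definition is_closed (M N : semi_closed_multicategory) (F : mfunctor M N) :
  Prop :=
  forall A B : ob M,
    mf_ob F (ihom A B) = ihom (mf_ob F A) (mf_ob F B) /\
    mf_mor F (ev A B) = ev (mf_ob F A) (mf_ob F B).

Record semi_closed_operad := SemiClosedOperad {
  sco_mcat :> semi_closed_multicategory;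
  star : ob sco_mcat;
  star_unique : forall A : ob sco_mcat, A = star
}.

Arguments star {s}.

Record closed_functor (M N : semi_closed_operad) := ClosedFunctor {
  clf_mfun :> mfunctor M N;
  clf_closed : is_closed clf_mfun
}.

Lemma closed_functor_eq (M N : semi_closed_operad) (F G : closed_functor M N) :
  mf_ob F =1 mf_ob G -> mf_mor F =1 mf_mor G -> F = G.
Proof.
case: F G => [F cF] [G cG] /= eo em.
have eFG := mfunctor_eq eo em; subst G.
by congr ClosedFunctor; exact: proof_irrelevance.
Qed.

Program Definition closed_functor_id (M : semi_closed_operad) :
  closed_functor M M := @ClosedFunctor M M (mfunctor_id M) _.
Next Obligation. by []. Qed.

Program Definition closed_functor_comp (M N P : semi_closed_operad)
    (G : closed_functor N P) (F : closed_functor M N) : closed_functor M P :=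
  @ClosedFunctor M P (mfunctor_comp G F) _.
Next Obligation.
move=> M N P G F A B /=.
have [-> ->] := clf_closed F A B.
by have [-> ->] := clf_closed G (mf_ob F A) (mf_ob F B).
Qed.

Program Definition O_s : category :=
  @Category semi_closed_operad closed_functor closed_functor_id
    closed_functor_comp _ _ _.
Next Obligation. by move=> *; apply: closed_functor_eq. Qed.
Next Obligation. by move=> *; apply: closed_functor_eq. Qed.
Next Obligation. by move=> *; apply: closed_functor_eq. Qed.

Section Applicative.
Variables (M : multicategory) (A : ob M) (bul : mor M).

Definition applicative_system : Prop := mhom [:: A; A] A bul.

Fixpoint bullet (n : nat) : mor M :=
  if n is n'.+1 then comp bul [:: bullet n'; idm A] else idm A.

Definition point (a : mor M) : Prop := mhom [::] A a.

(* The polynomial function x_1,...,x_n |-> a x_1 ... x_n of M(A^n;A). *)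
Definition poly (n : nat) (a : mor M) : mor M :=
  comp (bullet n) (a :: nseq n (idm A)).

Definition represents (n : nat) (a f : mor M) : Prop :=
  point a /\ poly n a = f.

Definition computable (n : nat) (f : mor M) : Prop :=
  mhom (nseq n A) A f /\ exists a, represents n a f.

Definition planar_combinatory_algebra : Prop :=
  [/\ applicative_system,
      computable 3 (comp bul [:: idm A; bul]),
      computable 1 (idm A)
    & forall a, point a -> computable 1 (comp bul [:: idm A; a])].

Local Notation "x · y" := (comp bul [:: x; y])
  (at level 40, left associativity).

Definition combinator_choice (B I : mor M) (dot : mor M -> mor M) : Prop :=
  [/\ represents 3 B (comp bul [:: idm A; bul]),
      represents 1 I (idm A)
    & forall a, point a -> represents 1 (dot a) (comp bul [:: idm A; a])].

Definition planar_lambda_axioms (B I : mor M) (dot : mor M -> mor M) : Prop :=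
  (B · (B · (B · I)) · B = B) /\
  (B · I · I = I) /\
  (forall a, point a -> B · I · dot a = dot a) /\
  (B · dot B · (B · B · (B · B · B)) = B · (B · B) · B) /\
  (B · dot I · B = B · I) /\
  (forall a, point a -> B · dot (dot a) · B = B · (B · dot a) · B) /\
  (forall a b, point a -> point b ->
     dot (a · b) = B · dot b · (B · dot a · B)).

(* The power a^{*n} for a * b = B a b. *)
Fixpoint star_power (B I a : mor M) (n : nat) : mor M :=
  if n is n'.+1 then B · star_power B I a n' · a else I.

Definition weakly_multi_extensional (B I : mor M) : Prop :=
  forall (n : nat) (a b : mor M), point a -> point b ->
    poly n a = poly n b ->
    star_power B I B n · I · a = star_power B I B n · I · b.

(* The choice of B, I and a^bullet is required to exist but is not part of the
   data: morphisms of s-triples are not asked to preserve it. *)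
Definition planar_lambda_model : Prop :=
  planar_combinatory_algebra /\
  exists (B I : mor M) (dot : mor M -> mor M),
    [/\ combinator_choice B I dot,
        planar_lambda_axioms B I dot
      & weakly_multi_extensional B I].

End Applicative.

Record s_triple := STriple {
  st_mcat : multicategory;
  st_ob : ob st_mcat;
  st_bul : mor st_mcat;
  st_model : planar_lambda_model st_ob st_bul
}.

Record s_morphism (S T : s_triple) := SMorphism {
  sm_mfun :> mfunctor (st_mcat S) (st_mcat T);
  sm_ob : mf_ob sm_mfun (st_ob S) = st_ob T;
  sm_bul : mf_mor sm_mfun (st_bul S) = st_bul T
}.

Lemma s_morphism_eq (S T : s_triple) (F G : s_morphism S T) :
  mf_ob F =1 mf_ob G -> mf_mor F =1 mf_mor G -> F = G.
Proof.
case: F G => [F oF bF] [G oG bG] /= eo em.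
have eFG := mfunctor_eq eo em; subst G.
by congr SMorphism; exact: proof_irrelevance.
Qed.

Program Definition s_morphism_id (T : s_triple) : s_morphism T T :=
  @SMorphism T T (mfunctor_id (st_mcat T)) _ _.
Next Obligation. by []. Qed.
Next Obligation. by []. Qed.

Program Definition s_morphism_comp (S T U : s_triple)
    (G : s_morphism T U) (F : s_morphism S T) : s_morphism S U :=
  @SMorphism S U (mfunctor_comp G F) _ _.
Next Obligation. by move=> S T U G F /=; rewrite !sm_ob. Qed.
Next Obligation. by move=> S T U G F /=; rewrite !sm_bul. Qed.

Program Definition T_s : category :=
  @Category s_triple s_morphism s_morphism_id s_morphism_comp _ _ _.
Next Obligation. by move=> *; apply: s_morphism_eq. Qed.
Next Obligation. by move=> *; apply: s_morphism_eq. Qed.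
Next Obligation. by move=> *; apply: s_morphism_eq. Qed.

(* [L_well_defined] and [R_well_defined] are the facts making L and R
   meaningful on objects.  Being propositions, they only certify that the
   explicit data below are objects of the target category; the data themselves
   do not depend on the proofs chosen. *)
Definition L_well_defined : Prop :=
  forall M : semi_closed_operad, planar_lambda_model star (@ev M star star).

Section L.
Variable hL : L_well_defined.

Definition L_ob (M : semi_closed_operad) : s_triple := STriple (hL M).

Program Definition L_mor (M N : semi_closed_operad) (F : closed_functor M N) :
  s_morphism (L_ob M) (L_ob N) := @SMorphism (L_ob M) (L_ob N) F _ _.
Next Obligation. by move=> M N F /=; exact: star_unique. Qed.
Next Obligation.
move=> M N F /=; have [_ ->] := clf_closed F star star.
by rewrite (star_unique (mf_ob F star)).
Qed.

Program Definition L_s : functor O_s T_s := @Functor O_s T_s L_ob L_mor _ _.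
Next Obligation. by move=> M; apply: s_morphism_eq. Qed.
Next Obligation. by move=> M N P G F; apply: s_morphism_eq. Qed.

End L.

Section ComputableOperad.
Variable T : s_triple.
Local Notation M := (st_mcat T).
Local Notation A := (st_ob T).
Local Notation bul := (st_bul T).

Definition is_computable (f : mor M) : Prop := exists n, computable A bul n f.

(* The arity n is recovered from f as the length of its domain A^n. *)
Definition R_morphism : Type := {f : mor M | is_computable f}.

Definition R_closed : Prop :=
  forall (f : R_morphism) (gs : seq R_morphism),
    map cod (map sval gs) = dom (sval f) ->
    is_computable (comp (sval f) (map sval gs)).

Lemma R_morphism_eq (f g : R_morphism) : sval f = sval g -> f = g.
Proof.
by case: f g => [f hf] [g hg] /= e; subst g; congr exist; exact: proof_irrelevance.
Qed.

Definition R_dom (f : R_morphism) : seq unit := nseq (size (dom (sval f))) tt.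
Definition R_cod (f : R_morphism) : unit := tt.

Lemma cod_computable (f : R_morphism) : cod (sval f) = A.
Proof. by case: f => f [n [[]]]. Qed.

Lemma dom_computable (f : R_morphism) :
  dom (sval f) = nseq (size (dom (sval f))) A.
Proof. by case: f => f [n [[/= -> _] _]]; rewrite size_nseq. Qed.

Lemma R_composable (f : R_morphism) (gs : seq R_morphism) :
  map R_cod gs = R_dom f -> map cod (map sval gs) = dom (sval f).
Proof.
move=> /(congr1 size); rewrite size_map size_nseq => e.
rewrite dom_computable -e.
by elim: gs {e} => //= g gs ->; rewrite cod_computable.
Qed.

Lemma applicative_bul : applicative_system A bul.
Proof. by have [[]] := st_model T. Qed.

Lemma is_computable_id : is_computable (idm A).
Proof. by exists 1; have [[]] := st_model T. Qed.

Lemma is_computable_bul : is_computable bul.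
Proof.
have [dbul cbul] := applicative_bul.
have [[_ _ [_ [I [ptI rI]]] _] _] := st_model T.
have [dI cI] := ptI.
have idmA (f : mor M) : cod f = A -> comp (idm A) [:: f] = f.
  by move=> <-; exact: comp1f.
exists 2; split=> //; exists I; split=> //.
rewrite /poly /= in rI *.
have e1 : comp bul [:: idm A; idm A] = bul.
  by have := compf1 bul; rewrite dbul.
rewrite e1 in rI *.
have e2 : map cod [:: bul; idm A] = dom bul by rewrite /= cbul cod_id dbul.
rewrite -(@compA _ bul [:: bul; idm A] [:: [:: I; idm A]; [:: idm A]]) //=.
  by rewrite rI (idmA _ (cod_id A)) e1.
by rewrite cI dbul dom_id cod_id.
Qed.

Hypothesis hC : R_closed.

Definition R_id (x : unit) : R_morphism := exist _ _ is_computable_id.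

Definition R_comp (f : R_morphism) (gs : seq R_morphism) : R_morphism :=
  match map R_cod gs =P R_dom f with
  | ReflectT e => exist _ _ (hC (R_composable e))
  | ReflectF _ => f
  end.

Lemma sval_R_comp (f : R_morphism) (gs : seq R_morphism) :
  map R_cod gs = R_dom f -> sval (R_comp f gs) = comp (sval f) (map sval gs).
Proof. by rewrite /R_comp; case: eqP. Qed.

Lemma nseq_flatten (S : Type) (x : S) (s : seq nat) :
  flatten (map (fun n => nseq n x) s) = nseq (sumn s) x.
Proof. by elim: s => //= n s ->; rewrite nseqD. Qed.

Program Definition R_mcat : multicategory :=
  @Multicategory unit R_morphism R_dom R_cod R_id R_comp _ _ _ _ _ _ _ _.
Next Obligation. by case; rewrite /R_dom /= dom_id. Qed.
Next Obligation. by case. Qed.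
Next Obligation.
move=> f gs e; rewrite /R_dom sval_R_comp // dom_comp; last exact: R_composable.
rewrite size_flatten /shape -!map_comp.
rewrite (map_comp (fun n => nseq n tt) (fun g : R_morphism => size (dom (sval g)))).
by rewrite nseq_flatten.
Qed.
Next Obligation. by []. Qed.
Next Obligation. by move=> f gs ne; rewrite /R_comp; case: eqP. Qed.
Next Obligation.
move=> f; apply: R_morphism_eq; rewrite sval_R_comp /=.
  by rewrite -(cod_computable f) comp1f.
by rewrite /R_dom /= dom_id.
Qed.
Next Obligation.
move=> f; apply: R_morphism_eq; rewrite sval_R_comp.
  have -> : map sval (map R_id (R_dom f)) = map idm (dom (sval f)).
    by rewrite dom_computable /R_dom !map_nseq.
  exact: compf1.
by rewrite /R_dom -map_comp map_nseq.
Qed.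
Next Obligation.
move=> f gs hss ef eg; apply: R_morphism_eq.
have eS : size hss = size gs by have := congr1 size eg; rewrite !size_map.
have ec : map R_cod [seq R_comp p.1 p.2 | p <- zip gs hss] = R_dom f.
  rewrite -ef -!map_comp.
  rewrite (eq_map (g := (fun _ => tt) \o fst)) //.
  by rewrite map_comp -/(unzip1 _) unzip1_zip // eS.
have eh : map R_cod (flatten hss) = R_dom (R_comp f gs).
  have -> : R_dom (R_comp f gs) = flatten (map R_dom gs).
    exact: (R_mcat_obligation_3 ef).
  by rewrite map_flatten eg.
rewrite !sval_R_comp // map_flatten.
have -> : map sval [seq R_comp p.1 p.2 | p <- zip gs hss]
    = [seq comp p.1 p.2 | p <- zip (map sval gs) (map (map sval) hss)].
  elim: gs hss eg {ef eS ec eh} => [|g gs IH] [|hs hss] //= [e1 e2].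
  by rewrite sval_R_comp // IH.
rewrite compA //; first exact: R_composable.
elim: gs hss eg {ef eS ec eh} => [|g gs IH] [|hs hss] //= [e1 e2].
by rewrite IH //; congr cons; exact: R_composable.
Qed.

Definition R_ihom (x y : ob R_mcat) : ob R_mcat := tt.
Definition R_ev (x y : ob R_mcat) : mor R_mcat := exist _ bul is_computable_bul.

End ComputableOperad.

Record R_well_defined : Prop := RWellDefined {
  R_wd_closed : forall T : s_triple, R_closed T;
  R_wd_semi_closed : forall T : s_triple,
    semi_closed (@R_ihom T (@R_wd_closed T)) (@R_ev T (@R_wd_closed T))
}.

Arguments R_wd_closed _ _ : clear implicits.
Arguments R_wd_semi_closed _ _ : clear implicits.

Section R.
Variable hR : R_well_defined.

Program Definition R_ob (T : s_triple) : semi_closed_operad :=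
  @SemiClosedOperad
    (@SemiClosedMulticategory (R_mcat (R_wd_closed hR T)) _ _
       (R_wd_semi_closed hR T)) tt _.
Next Obligation. by move=> T; case. Qed.

Lemma cod_bullet (T : s_triple) n : cod (bullet (st_ob T) (st_bul T) n) = st_ob T.
Proof.
have [dbul cbul] := applicative_bul T.
by elim: n => [|n IH] /=; rewrite ?cod_id // cod_comp //= IH cod_id dbul.
Qed.

Lemma dom_bullet (T : s_triple) n :
  dom (bullet (st_ob T) (st_bul T) n) = nseq n.+1 (st_ob T).
Proof.
have [dbul cbul] := applicative_bul T.
elim: n => [|n IH] /=; first exact: dom_id.
rewrite dom_comp /= ?cod_bullet ?cod_id ?dbul // IH dom_id cats0.
by rewrite -[[:: st_ob T]]/(nseq 1 _) -nseqD addn1.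
Qed.

Lemma s_morphism_bullet (S T : s_triple) (F : s_morphism S T) n :
  mf_mor F (bullet (st_ob S) (st_bul S) n) = bullet (st_ob T) (st_bul T) n.
Proof.
have [dbul cbul] := applicative_bul S.
elim: n => [|n IH] /=; first by rewrite mf_id sm_ob.
rewrite mf_comp /= ?cod_bullet ?cod_id ?dbul //.
by rewrite IH mf_id sm_ob sm_bul.
Qed.

Lemma s_morphism_computable (S T : s_triple) (F : s_morphism S T) f :
  is_computable f -> is_computable (T := T) (mf_mor F f).
Proof.
move=> [n [[df cf] [a [[da ca] e]]]]; exists n; split.
  by split; rewrite ?mf_dom ?mf_cod ?df ?cf ?map_nseq sm_ob.
exists (mf_mor F a); split; first by split; rewrite ?mf_dom ?mf_cod ?da ?ca ?sm_ob.
rewrite -e /poly mf_comp.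
  by rewrite s_morphism_bullet /= map_nseq mf_id sm_ob.
by rewrite dom_bullet /= ca map_nseq cod_id.
Qed.

Definition R_fun (S T : s_triple) (F : s_morphism S T)
    (f : R_morphism S) : R_morphism T :=
  exist _ _ (s_morphism_computable F (proj2_sig f)).

Program Definition R_mor (S T : s_triple) (F : s_morphism S T) :
    closed_functor (R_ob S) (R_ob T) :=
  @ClosedFunctor (R_ob S) (R_ob T)
    (@MFunctor (R_ob S) (R_ob T) id (R_fun F) _ _ _ _) _.
Next Obligation.
by move=> S T F f; rewrite map_id /= /R_dom /= mf_dom size_map.
Qed.
Next Obligation. by []. Qed.
Next Obligation.
by move=> S T F A; apply: R_morphism_eq; rewrite /= mf_id sm_ob.
Qed.
Next Obligation.
move=> S T F f gs e; apply: R_morphism_eq.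
rewrite /= sval_R_comp // mf_comp; last exact: R_composable.
rewrite sval_R_comp /=; first by rewrite -!map_comp.
have <- : map (@R_cod S) gs = R_dom (R_fun F f).
  by rewrite /R_dom /= mf_dom size_map; exact: e.
by rewrite -map_comp.
Qed.
Next Obligation.
by move=> S T F A B; split=> //; apply: R_morphism_eq; rewrite /= sm_bul.
Qed.

Program Definition R_s : functor T_s O_s := @Functor T_s O_s R_ob R_mor _ _.
Next Obligation.
by move=> T; apply: closed_functor_eq => // f; apply: R_morphism_eq.
Qed.
Next Obligation.
by move=> S T U G F; apply: closed_functor_eq => // f; apply: R_morphism_eq.
Qed.

End R.

(* Main.v *)
(** In a semi-closed operad every morphism is computable, and an equation
    between abstractions may be checked after applying both sides to the identity; so
    [P.1]-[P.7] and weak multi-extensionality reduce to the rewriting rules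
    B f g h = f (g h), I f = f and a^bullet f = f a for open terms.

    Conversely, let I_n = B (... (B I)) (n times), so that I_n a abstracts
    a x_1 ... x_n.  Weak multi-extensionality makes the abstraction
    Lambda(f) = (x_1,...,x_n |-> I_{n+1} a x_1 ... x_n) independent of the
    representative a of f.  If b_i represents g_i of arity k_i, then
    E_1 = (b_1^bullet * B^{*k_1}) * B E_2 (and so on, ending with I) sends a
    representative of f to one of f o (g_1,...,g_n), and [P.4]-[P.6] give
    I_{m+p} * E_1 = E_1 * I_{n+p} with m = k_1 + ... + k_n.  For p = 1 this says
    that E_1 commutes with abstraction over one further variable, which is the
    naturality of Lambda.

    The unit sends f to itself seen as a computable morphism, and the counit is
    the inclusion of the computable morphisms. *)
From Stdlib Require Import IndefiniteDescription.
From mathcomp Require Import all_boot.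
Require Import Defs.

Set Implicit Arguments.
Unset Strict Implicit.
Unset Printing Implicit Defensive.

(** * Substitution and application in an applicative system *)

Section ApplicativeTerms.
Variables (M : multicategory) (A : ob M) (bul : mor M).
Hypothesis bulP : applicative_system A bul.
Implicit Types (f g h a b x y z : mor M) (fs gs : seq (mor M)).

Local Notation one := (idm A).
Local Notation "x · y" := (comp bul [:: x; y])
  (at level 40, left associativity).

(** By [polyE] this is [poly n f] when [f] has codomain [A], but built by adding one argument on the
    outside at a time. Here [f] may be open; the new variables come after those of [f]. *)
Definition saturate (n : nat) f : mor M := iter n (fun h => h · one) f.

Definition app_seq f gs : mor M := foldl (fun h g => h · g) f gs.

Lemma composable_app f g : cod f = A -> cod g = A ->
  map cod [:: f; g] = dom bul.
Proof. by move=> /= -> ->; case: bulP. Qed.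

Lemma cod_app f g : cod f = A -> cod g = A -> cod (f · g) = A.
Proof. by move=> cf cg; rewrite cod_comp ?composable_app //; case: bulP. Qed.

Lemma dom_app f g : cod f = A -> cod g = A -> dom (f · g) = dom f ++ dom g.
Proof. by move=> cf cg; rewrite dom_comp ?composable_app //= cats0. Qed.

Lemma comp_app f g fs gs : cod f = A -> cod g = A ->
  map cod fs = dom f -> map cod gs = dom g ->
  comp (f · g) (fs ++ gs) = comp f fs · comp g gs.
Proof.
move=> cf cg ef eg.
have := @compA M bul [:: f; g] [:: fs; gs] (composable_app cf cg).
by rewrite /= ef eg cats0 => <-.
Qed.

Lemma comp_one f : cod f = A -> comp one [:: f] = f.
Proof. by move=> <-; exact: comp1f. Qed.

Lemma comp_nil f : dom f = [::] -> comp f [::] = f.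
Proof. by move=> e; have := compf1 f; rewrite e. Qed.

Lemma cod_saturate n f : cod f = A -> cod (saturate n f) = A.
Proof. by move=> cf; elim: n => //= n IH; rewrite cod_app ?cod_id. Qed.

Lemma dom_saturate n f : cod f = A -> dom (saturate n f) = dom f ++ nseq n A.
Proof.
move=> cf; elim: n => [|n IH] /=; first by rewrite cats0.
rewrite dom_app ?cod_saturate ?cod_id // IH dom_id -catA.
by rewrite -[[:: A]]/(nseq 1 A) -nseqD addn1.
Qed.

(** As [a] is closed, the only inputs of the saturated term are the new variables, and substitution
    replaces them from left to right. *)
Lemma comp_saturate a gs : point A a -> map cod gs = nseq (size gs) A ->
  comp (saturate (size gs) a) gs = app_seq a gs.
Proof.
move=> [da ca]; elim/last_ind: gs => [|gs g IH]; first by rewrite comp_nil.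
rewrite size_rcons map_rcons -addn1 nseqD cats1 => /rcons_inj [egs cg].
rewrite addn1 /= /app_seq -cats1 foldl_cat /= comp_app ?cod_saturate ?cod_id //.
- by rewrite IH // comp_one.
- by rewrite dom_saturate // da.
- by rewrite /= dom_id cg.
Qed.

Lemma cod_dom_bullet n :
  cod (bullet A bul n) = A /\ dom (bullet A bul n) = nseq n.+1 A.
Proof.
elim: n => [|n [IHc IHd]] /=; first by rewrite cod_id dom_id.
rewrite cod_app ?dom_app ?cod_id // IHd dom_id; split=> //.
by rewrite -[[:: A]]/(nseq 1 A) -nseqD addn1.
Qed.

Lemma polyE n f : cod f = A -> poly A bul n f = saturate n f.
Proof.
move=> cf; elim: n => [|n IH] /=; first by rewrite /poly /= comp_one.
have [cb db] := cod_dom_bullet n.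
have -> : poly A bul n.+1 f = comp (bullet A bul n · one)
    ((f :: nseq n one) ++ [:: one]) by rewrite /poly -addn1 nseqD addn1.
rewrite comp_app ?cod_id ?dom_id //= ?map_nseq ?cod_id ?cf ?db //.
by rewrite -/(poly A bul n f) IH comp_one ?cod_id.
Qed.

Lemma dom_app_seq f gs : cod f = A -> map cod gs = nseq (size gs) A ->
  dom (app_seq f gs) = dom f ++ flatten (map dom gs).
Proof.
elim: gs f => [|g gs IH] f cf /=; first by rewrite cats0.
by move=> [cg cgs]; rewrite IH ?cod_app // dom_app // catA.
Qed.

(** * Rewriting rules for the combinators *)

Section Combinators.
Variables (B I : mor M) (dot : mor M -> mor M).
Hypothesis ch : combinator_choice A bul B I dot.

Lemma point_B : point A B. Proof. by case: ch => [[]]. Qed.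
Lemma point_I : point A I. Proof. by case: ch => [_ []]. Qed.
Lemma point_dot a : point A a -> point A (dot a).
Proof. by case: ch => [_ _ d] /d []. Qed.

(** Turns the definition of a representative into a rewriting rule valid for open arguments; [appI],
    [appB] and [app_dot] are its instances. *)
Lemma represents_comp n a f gs : represents A bul n a f ->
  map cod gs = nseq n A -> comp f gs = app_seq a gs.
Proof.
move=> [pa <-] egs; have := congr1 size egs; rewrite size_map size_nseq => en.
by rewrite polyE; [rewrite -en comp_saturate // en | case: pa].
Qed.

Lemma appI f : cod f = A -> I · f = f.
Proof.
move=> cf; case: ch => [_ rI _].
by rewrite -[RHS](comp_one cf) (represents_comp rI) //= cf.
Qed.

Lemma appB f g h : cod f = A -> cod g = A -> cod h = A ->
  B · f · g · h = f · (g · h).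
Proof.
move=> cf cg ch'; case: ch => [rB _ _].
have := represents_comp (gs := [:: f; g; h]) rB.
rewrite /= cf cg ch' => /(_ erefl) <-.
have [db cb] := bulP.
rewrite -[[:: f; g; h]]/([:: f] ++ [:: g; h]).
by rewrite comp_app ?cod_id ?dom_id ?db //= ?cf ?cg ?ch' // comp_one.
Qed.

Lemma app_dot a f : point A a -> cod f = A -> dot a · f = f · a.
Proof.
move=> pa cf; case: ch => [_ _ /(_ a pa) rd].
have := represents_comp (gs := [:: f]) rd.
rewrite /= cf => /(_ erefl) <-; case: (pa) => da ca.
rewrite -[[:: f]]/([:: f] ++ [::]).
by rewrite comp_app ?cod_id ?dom_id ?da //= ?cf // comp_one // comp_nil.
Qed.

Lemma cod_B : cod B = A. Proof. by case: point_B. Qed.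
Lemma cod_I : cod I = A. Proof. by case: point_I. Qed.
Lemma cod_dot a : point A a -> cod (dot a) = A. Proof. by case/point_dot. Qed.
Lemma cod_point a : point A a -> cod a = A. Proof. by case. Qed.

Lemma point_app a b : point A a -> point A b -> point A (a · b).
Proof. by move=> [da ca] [db cb]; split; rewrite ?dom_app ?da ?db ?cod_app. Qed.

Local Notation "x ⋆ y" := (B · x · y) (at level 45, left associativity).

(** By [star_power_app] this is the term B^{*n} I of weak multi-extensionality. *)
Definition lift_id (n : nat) : mor M := iter n (fun x => B · x) I.

Lemma point_star x y : point A x -> point A y -> point A (x ⋆ y).
Proof. by move=> px py; do 2?apply: point_app => //; exact: point_B. Qed.

Lemma point_lift_id n : point A (lift_id n).
Proof.
elim: n => [|n IH]; [exact: point_I | exact: point_app point_B IH].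
Qed.

Lemma point_star_power x n : point A x -> point A (star_power bul B I x n).
Proof.
by move=> px; elim: n => [|n IH]; [exact: point_I | exact: point_star].
Qed.

Lemma star_power_app n x : cod x = A ->
  star_power bul B I B n · x = iter n (fun y => B · y) x.
Proof.
have cB := cod_B; have pB := point_B.
elim: n x => [|n IH] x cx /=; first exact: appI.
rewrite appB // ?(cod_point (point_star_power _ _)) //.
by rewrite IH ?cod_app // -iterSr.
Qed.

(** Each B hands one variable over to [f], and the innermost I then disappears. *)
Lemma saturate_lift_id n f : cod f = A ->
  saturate n (lift_id n · f) = saturate n f.
Proof.
elim: n f => [|n IH] f cf; first exact: appI.
rewrite /saturate !iterSr /= appB ?cod_id //.
  by apply: IH; rewrite cod_app ?cod_id.
exact: cod_point (point_lift_id n).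
Qed.

(** B^{*k} is composition after k arguments: [g] receives its k variables before [f] is applied to
    the result. *)
Lemma saturate_star_power_B k f g : cod f = A -> cod g = A ->
  saturate k (star_power bul B I B k · f · g) = f · saturate k g.
Proof.
have cB := cod_B; have pB := point_B.
elim: k f => [|k IH] f cf cg /=; first by rewrite appI.
rewrite (@appB (star_power bul B I B k)) //; last first.
  exact: cod_point (point_star_power _ _).
by rewrite IH ?cod_app // appB ?cod_saturate ?cod_id.
Qed.

(** * Consequences of the planar axioms, and the combinator for multicategorical composition *)

Section PlanarEquations.
Hypothesis ax : planar_lambda_axioms A bul B I dot.

Lemma app_star x y z : point A x -> point A y -> cod z = A ->
  (x ⋆ y) · z = x · (y · z).
Proof. by move=> [_ cx] [_ cy] cz; rewrite appB. Qed.

(* [P.4] applied to [x]. *)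
Lemma starB x : point A x -> B · (B · x) ⋆ B = B ⋆ B · x.
Proof.
move=> px; have cx := cod_point px; have cB := cod_B; have pB := point_B.
case: ax => _ [_ [_ [/(congr1 (fun z => z · x)) P4 _]]].
by move: P4; rewrite !(appB, app_dot, cod_app, cod_dot).
Qed.

(** Apply both sides of [starB] to [y]. *)
Lemma app_B_star x y : point A x -> point A y ->
  B · (x ⋆ y) = B · x ⋆ B · y.
Proof.
move=> px py; have pB := point_B.
have /(congr1 (fun z => z · y)) := starB px.
by rewrite !app_star ?(cod_point py) //; auto using point_app.
Qed.

(** Apply both sides of [app_B_star] to [z]. *)
Lemma starA x y z : point A x -> point A y -> point A z ->
  x ⋆ (y ⋆ z) = x ⋆ y ⋆ z.
Proof.
move=> px py pz; have pB := point_B.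
have /(congr1 (fun w => w · z)) := app_B_star px py.
by rewrite (@app_star (B · x)) ?(cod_point pz) //; auto using point_app.
Qed.

(* [P.6] applied to [x]. *)
Lemma star_dot a x : point A a -> point A x ->
  dot a ⋆ B · x = x ⋆ dot a.
Proof.
move=> pa px; have pB := point_B; have pd := point_dot pa.
case: ax => _ [_ [_ [_ [_ [/(_ a pa) /(congr1 (fun z => z · x)) P6 _]]]]].
move: P6; rewrite !app_star ?(cod_point px) //; auto using point_app, point_dot.
by rewrite app_dot // cod_app ?cod_B ?(cod_point px).
Qed.

(* [P.5] applied to [x]. *)
Lemma star_I x : point A x -> x ⋆ I = I ⋆ x.
Proof.
move=> px; have pB := point_B; have pI := point_I; have pd := point_dot pI.
case: ax => _ [_ [_ [_ [/(congr1 (fun z => z · x)) P5 _]]]].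
move: P5; rewrite app_star ?(cod_point px) //.
by rewrite app_dot // cod_app ?cod_B ?(cod_point px).
Qed.

(** Each B in the power is crossed by [starB] and costs one index. The successor on the right
    guarantees the two nested B's that [starB] requires. *)
Lemma lift_id_star_power k q :
  lift_id (k + q).+1 ⋆ star_power bul B I B k
  = star_power bul B I B k ⋆ lift_id q.+1.
Proof.
have pB := point_B; have pI := point_I.
have pl := point_lift_id; have ps k' := point_star_power k' pB.
elim: k q => [|k IH] q; first by rewrite star_I.
rewrite [star_power _ _ _ _ k.+1]/= starA // addSnnS IH -starA //.
rewrite -[lift_id q.+2]/(B · (B · lift_id q)) starB //.
exact: (starA (ps k) pB (pl q.+1)).
Qed.

Lemma composition_combinator
    (gs : seq {g : mor M | exists n, computable A bul n g}) :
  let ts := map sval gs in let m := size (flatten (map dom ts)) in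
  exists E, [/\ point A E,
    forall f, cod f = A -> saturate m (E · f) = app_seq f ts
  & forall p, lift_id (m + p) ⋆ E = E ⋆ lift_id (size gs + p)].
Proof.
have pB := point_B; have pI := point_I.
have pl := point_lift_id; have ps k := point_star_power k pB.
elim: gs => [|[g [k [[dg cg] [b [pb eb]]]]] gs [E [pE satE liftE]]] /=.
  exists I; split=> // [f cf|p]; last by rewrite -star_I.
  by rewrite /saturate /= appI.
have pd := point_dot pb; have pBE : point A (B · E) by exact: point_app.
have pS : point A (dot b ⋆ star_power bul B I B k) by exact: point_star.
have cS := cod_point pS; have cb := cod_point pb.
exists (dot b ⋆ star_power bul B I B k ⋆ B · E).
rewrite dg size_cat size_nseq; split=> [|f cf|p].
- exact: point_star.
- have cEf : cod (B · E · f) = A by rewrite cod_app // (cod_point pBE).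
  have cSf : cod (star_power bul B I B k · (B · E · f)) = A.
    by rewrite cod_app // (cod_point (ps k)).
  rewrite app_star // app_star //.
  rewrite app_dot //.
  (* The first k variables belong to g and must be supplied first; the remaining ones are left to
     [E]. *)
  rewrite addnC /saturate iterD -/(saturate k _) -/(saturate _ _).
  rewrite saturate_star_power_B // -(polyE k cb) eb.
  by rewrite appB ?(cod_point pE) // satE // cod_app.
- set m := size (flatten _); set n := size gs.
  set S := star_power bul B I B k in pS cS *.
  have pSBE : point A (S ⋆ B · E) by apply: point_star => //; exact: ps.
  have pX j : point A (B · lift_id j) by exact: point_app.
  (* The lifting moves rightwards through the three factors: crossing [dot b] adds one B, crossing
     B^{*k} removes k, and [B · E] is crossed by the induction hypothesis under B. The B gained at
     [dot b] accounts for the additional argument g. *)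
  rewrite -(starA pd (ps k) pBE) (starA (pl _) pd pSBE) -star_dot // -addnA.
  rewrite -(starA pd (pX _) pSBE) -[B · lift_id _]/(lift_id (k + _).+1).
  rewrite (starA (pl _) (ps k) pBE) lift_id_star_power.
  rewrite -(starA (ps k) (pl _) pBE) -[lift_id _.+1]/(B · lift_id _).
  rewrite -app_B_star // liftE app_B_star //.
  by rewrite !starA //; exact: point_star.
Qed.
End PlanarEquations.

End Combinators.
End ApplicativeTerms.

(** * The computable morphisms form a semi-closed operad *)

Lemma map_cod_R_morphism (T : s_triple) (gs : seq (R_morphism T)) :
  map cod (map sval gs) = nseq (size gs) (st_ob T).
Proof. by elim: gs => //= g gs ->; rewrite cod_computable. Qed.

(** If [a] represents [f], then [E] applied to [a] represents the composite. *)
Lemma R_closedP (T : s_triple) : R_closed T.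
Proof.
move=> [f [n [[df cf] [a [pa ea]]]]] gs /= e; have bulP := applicative_bul T.
have [_ [B [I [dot [ch ax _]]]]] := st_model T; have ca := cod_point pa.
have sn : size gs = n by have := congr1 size e; rewrite df !size_map size_nseq.
have [E [pE satE _]] := composition_combinator bulP ch ax gs.
have pd := point_app bulP pE pa; have cgs := map_cod_R_morphism gs.
exists (size (flatten (map dom (map sval gs)))); split; last first.
  exists (comp (st_bul T) [:: E; a]); split=> //.
  rewrite polyE ?(cod_point pd) // satE //.
  by rewrite (@represents_comp _ _ _ bulP n a) // -?sn.
split; last by rewrite cod_comp.
have eD : flatten (map dom (map sval gs))
    = flatten (map (fun k => nseq k (st_ob T))
        (map (fun g : R_morphism T => size (dom (sval g))) gs)).
  rewrite -!map_comp; congr flatten.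
  by apply: eq_map => g; exact: dom_computable.
by rewrite dom_comp // eD nseq_flatten size_nseq.
Qed.

Section RSemiClosed.
Variable T : s_triple.
Local Notation M := (st_mcat T).
Local Notation A := (st_ob T).
Local Notation bul := (st_bul T).
Let bulP := applicative_bul T.
Let hC := @R_closedP T.
Variables (B I : mor M) (dot : mor M -> mor M).
Hypothesis ch : combinator_choice A bul B I dot.
Hypothesis ax : planar_lambda_axioms A bul B I dot.
Hypothesis wme : weakly_multi_extensional A bul B I.

(** The representative is normalised by being fixed by the lifting of length n+1. In arity zero the
    condition is vacuous, so that the relation is total and a choice function can be extracted. *)
Definition abstraction_of (f h : R_morphism T) : Prop :=
  forall n, size (dom (sval f)) = n.+1 -> exists a,
    [/\ represents A bul n.+1 a (sval f),
        comp bul [:: lift_id bul B I n.+1; a] = a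
      & sval h = poly A bul n a].

Lemma wme_lift_id n a b : point A a -> point A b ->
  poly A bul n a = poly A bul n b ->
  comp bul [:: lift_id bul B I n; a] = comp bul [:: lift_id bul B I n; b].
Proof.
move=> pa pb /(wme pa pb).
by rewrite (star_power_app bulP ch _ (cod_I ch)).
Qed.

Lemma computable_poly n a : point A a -> is_computable (poly A bul n a).
Proof.
move=> pa; have [da ca] := pa; exists n; split; last by exists a.
by rewrite polyE //; split; rewrite ?dom_saturate ?cod_saturate // da.
Qed.

Lemma abstraction_exists f : exists h, abstraction_of f h.
Proof.
case: f => f [n [[df cf] [a [pa ea]]]].
case: n => [|n] in df ea *.
  (* An arbitrary value: there is no variable to abstract. *)
  by exists (R_id T tt) => n; rewrite /= df.
have pl := point_lift_id bulP ch.
have pc : point A (comp bul [:: lift_id bul B I n.+1; a]).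
  exact: point_app.
exists (exist _ _ (computable_poly n pc)) => k /=.
rewrite df size_nseq => -[<-].
have ec : poly A bul n.+1 (comp bul [:: lift_id bul B I n.+1; a]) = f.
  by rewrite !polyE ?(cod_point pc) // (saturate_lift_id bulP ch) -?polyE //;
    rewrite (cod_point pa).
exists (comp bul [:: lift_id bul B I n.+1; a]); split=> //.
(* The lifted representative has the same polynomial as [a], so lifting it again changes nothing. *)
by apply: (wme_lift_id (n := n.+1) pc pa); rewrite ec.
Qed.

Lemma R_semi_closed : semi_closed (R_ihom (hC := hC)) (R_ev (hC := hC)).
Proof.
split=> //.
  by move=> [] []; split=> //=; rewrite /R_dom /R_ev /=; have [-> _] := bulP.
have [lam lamP] := functional_choice abstraction_of abstraction_exists.
have domP (f : R_morphism T) n : mhom (M := R_mcat hC) (nseq n.+1 tt) tt f ->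
    size (dom (sval f)) = n.+1.
  by move=> [/(congr1 size)]; rewrite /= /R_dom !size_nseq.
have unitP (G : seq unit) : G = nseq (size G) tt.
  by elim: G => //= -[] G {1}->.
have rconsP (G : seq unit) x : rcons G x = nseq (size G).+1 tt.
  by rewrite [LHS]unitP size_rcons.
exists (fun _ _ _ => lam); split=> [G x y f|G x y f|G x y g fs].
- rewrite rconsP; case: y => /domP /lamP [a [[pa ea] _ el]].
  split=> //; rewrite /= /R_dom el polyE ?(cod_point pa) //.
  by rewrite dom_saturate ?(cod_point pa) // (proj1 pa) size_nseq -unitP.
- rewrite rconsP; case: y => /domP /lamP [a [[pa ea] _ el]].
  apply: R_morphism_eq; rewrite sval_R_comp /=.
    by rewrite el -ea !polyE ?(cod_point pa).
  by rewrite /R_dom /=; case: bulP => ->.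
- rewrite rconsP; case: y => gP egs; have sgs := congr1 size egs.
  rewrite size_map in sgs.
  have /lamP [a [[pa ea] la el]] := domP _ _ gP.
  have ca := cod_point pa.
  have efs : map (@R_cod T) (rcons fs (R_id T x)) = R_dom g.
    by rewrite /R_dom (domP _ _ gP) [LHS]unitP size_map size_rcons sgs.
  have efs' : map (@R_cod T) fs = R_dom (lam g).
    by rewrite [LHS]unitP /R_dom el polyE // dom_saturate // (proj1 pa)
      size_nseq size_map sgs.
  apply: R_morphism_eq; rewrite sval_R_comp // el.
  have [E [pE satE liftE]] := composition_combinator bulP ch ax fs.
  set m := size _ in satE liftE.
  have pd := point_app bulP pE pa.
  have cfs := map_cod_R_morphism fs.
  have cs : map cod (rcons (map sval fs) (idm A)) = nseq (size G).+1 A.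
    by rewrite map_rcons cfs cod_id -cats1 sgs -addn1 nseqD.
  have eg := R_composable efs; rewrite map_rcons /= in eg.
  have eR : sval (R_comp hC g (rcons fs (R_id T x)))
      = app_seq bul a (rcons (map sval fs) (idm A)).
    by rewrite sval_R_comp // map_rcons -(represents_comp bulP (conj pa ea)).
  have /lamP [c [[pc ec] lc ->]] :
      size (dom (sval (R_comp hC g (rcons fs (R_id T x))))) = m.+1.
    rewrite eR (dom_app_seq bulP) ?size_rcons ?size_map ?sgs // (proj1 pa).
    by rewrite cat0s map_rcons flatten_rcons dom_id size_cat /= addn1.
  (* Naturality now says that the normalised representative [c] chosen for the composite is [E]
     applied to the one chosen for [g]. *)
  suff -> : c = comp bul [:: E; a].
    rewrite polyE ?(cod_point pd) // satE //.
    by rewrite (represents_comp bulP (conj pa erefl)) // cfs sgs.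
  (* Since [E] commutes with lifting over one further variable and [a] is fixed by its lifting, [E]
     applied to [a] is normalised too. *)
  have ld : comp bul [:: lift_id bul B I m.+1; comp bul [:: E; a]]
      = comp bul [:: E; a].
    have pl := point_lift_id bulP ch.
    have := congr1 (fun z => comp bul [:: z; a]) (liftE 1).
    by rewrite !(app_star bulP ch) // !addn1 sgs la.
  (* Two normalised representatives of one morphism agree by weak multi-extensionality. *)
  rewrite -lc -ld; apply: (wme_lift_id (n := m.+1)) => //.
  rewrite ec eR [RHS]polyE ?(cod_point pd) //= satE //.
  by rewrite /app_seq foldl_rcons.
Qed.
End RSemiClosed.

(** * Every semi-closed operad carries a planar lambda-model *)

Section SemiClosedOperad.
Variable O : semi_closed_operad.
Local Notation bul := (@ev O star star).
Local Notation one := (idm (@star O)).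
Local Notation "x · y" := (comp bul [:: x; y])
  (at level 40, left associativity).
Implicit Types (f g h a b : mor O) (fs : seq (mor O)).

Lemma ob_starE (x : ob O) : x = star.
Proof. exact: star_unique. Qed.

Lemma seq_starE (s : seq (ob O)) : s = nseq (size s) star.
Proof. by elim: s => //= x s {1}->; rewrite (ob_starE x). Qed.

Lemma seq_ob_eq (s t : seq (ob O)) : size s = size t -> s = t.
Proof. by move=> e; rewrite [s]seq_starE [t]seq_starE e. Qed.

Lemma applicative_ev : applicative_system star bul.
Proof.
have [/(_ star star) [d c] _] := sc_semi_closed O.
by split; [rewrite d; exact: seq_ob_eq | exact: ob_starE].
Qed.

(** With a single object a context is determined by its length, so abstraction can be indexed by the
    morphism alone. The side conditions exclude arity zero, where nothing can be abstracted. *)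
Lemma ev_abstraction : exists lam : mor O -> mor O,
  [/\ forall f, dom f <> [::] -> size (dom f) = (size (dom (lam f))).+1,
      forall f, dom f <> [::] -> lam f · one = f
    & forall g fs, size (dom g) = (size fs).+1 ->
        lam (comp g (rcons fs one)) = comp (lam g) fs].
Proof.
have [_ [lam [lamP lam_ev lam_comp]]] := sc_semi_closed O.
have homP f : dom f <> [::] ->
    mhom (rcons (nseq (size (dom f)).-1 star) star) star f.
  move=> nf; split; last exact: ob_starE.
  by apply: seq_ob_eq; rewrite size_rcons size_nseq; case: (dom f) nf.
exists (fun f => lam (nseq (size (dom f)).-1 star) star star f).
split=> [f nf|f nf|g fs eg].
- have [-> _] := lamP _ _ _ _ (homP f nf).
  by rewrite size_nseq; case: (dom f) nf.
- exact: lam_ev (homP f nf).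
- have nf : dom g <> [::] by move=> e; rewrite e in eg.
  have efs : map cod fs = nseq (size (dom g)).-1 star.
    by apply: seq_ob_eq; rewrite size_map size_nseq eg.
  rewrite -(lam_comp _ _ _ _ _ (homP g nf) efs); congr lam.
  apply: seq_ob_eq; rewrite size_nseq dom_comp.
    by rewrite map_rcons flatten_rcons dom_id size_cat addn1.
  by apply: seq_ob_eq; rewrite size_map size_rcons eg.
Qed.

Section Abstraction.
Variable lam : mor O -> mor O.
Hypothesis dom_lam : forall f,
  dom f <> [::] -> size (dom f) = (size (dom (lam f))).+1.
Hypothesis lam_app : forall f, dom f <> [::] -> lam f · one = f.
Hypothesis lam_comp : forall g fs, size (dom g) = (size fs).+1 ->
  lam (comp g (rcons fs one)) = comp (lam g) fs.

Let bulP := applicative_ev.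
Let codE f : cod f = star := ob_starE (cod f).

(** The eta law for [f]. Semi-closedness provides only beta and naturality, so eta has to be tracked
    term by term. *)
Definition functional f : Prop := lam (f · one) = f.

Lemma functional_ext f g :
  functional f -> functional g -> f · one = g · one -> f = g.
Proof. by move=> cf cg e; rewrite -cf e. Qed.

Lemma functional_lam f : dom f <> [::] -> functional (lam f).
Proof. by move=> nf; rewrite /functional lam_app. Qed.

(** By naturality, abstracting (f x) with [fs] substituted for the variables of [f] is the
    abstraction of f x, which is [f], composed with [fs]. *)
Lemma functional_comp f fs : size (dom f) = size fs -> functional f ->
  functional (comp f fs).
Proof.
move=> ef cf; rewrite /functional -{2}cf -lam_comp; last first.
  by rewrite (dom_app bulP) ?codE // size_cat dom_id ef addn1.
rewrite -cats1 (comp_app bulP) ?comp_one ?dom_id ?codE //=.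
  by apply: seq_ob_eq; rewrite size_map.
by rewrite codE.
Qed.

Definition lam_n n f := iter n lam f.

Lemma saturate_lam_n n f : n <= size (dom f) ->
  size (dom f) = n + size (dom (lam_n n f)) /\
  saturate star bul n (lam_n n f) = f.
Proof.
elim: n => [|n IH] // lt.
have [IHd IHs] := IH (ltnW lt).
have nf : dom (lam_n n f) <> [::].
  by move=> e; rewrite IHd e addn0 ltnn in lt.
split; first by rewrite IHd (dom_lam nf) addnS.
by rewrite /saturate iterSr lam_app.
Qed.

Lemma point_of_dom f : dom f = [::] -> point star f.
Proof. by move=> df; split=> //; exact: ob_starE. Qed.

Lemma represents_lam_n f :
  represents star bul (size (dom f)) (lam_n (size (dom f)) f) f.
Proof.
have [d s] := saturate_lam_n (leqnn (size (dom f))).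
split; last by rewrite (polyE bulP) ?s //; exact: ob_starE.
apply: point_of_dom; apply: seq_ob_eq; apply/esym/(@addnI (size (dom f))).
by rewrite addn0.
Qed.

Lemma computable_ev f : computable star bul (size (dom f)) f.
Proof.
split; first by split; [exact: seq_starE | exact: ob_starE].
by exists (lam_n (size (dom f)) f); exact: represents_lam_n.
Qed.

Definition lam_B := lam (lam (lam (one · bul))).
Definition lam_I := lam one.
Definition lam_dot a := lam (one · a).

Lemma lam_combinators : combinator_choice star bul lam_B lam_I lam_dot.
Proof.
split; [have := represents_lam_n (one · bul)|have := represents_lam_n one|].
- by rewrite (dom_app bulP) ?codE // dom_id; case: bulP => -> _.
- by rewrite dom_id.
- move=> a [da ca]; have := represents_lam_n (one · a).
  by rewrite (dom_app bulP) ?codE // dom_id da.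
Qed.

Let appB' f g h : lam_B · f · g · h = f · (g · h).
Proof. exact (appB bulP lam_combinators (codE f) (codE g) (codE h)). Qed.

Let appI' f : lam_I · f = f.
Proof. exact (appI bulP lam_combinators (codE f)). Qed.

Let app_dot' a f : point star a -> lam_dot a · f = f · a.
Proof. by move=> pa; exact (app_dot bulP lam_combinators pa (codE f)). Qed.

Lemma size_dom_app f g : size (dom (f · g)) = size (dom f) + size (dom g).
Proof. by rewrite (dom_app bulP) ?size_cat //; exact: codE. Qed.

Lemma functional_app_seq a gs : point star a ->
  functional (saturate star bul (size gs) a) -> functional (app_seq bul a gs).
Proof.
move=> pa fa; rewrite -(comp_saturate bulP pa).
  apply: functional_comp fa; rewrite (dom_saturate bulP) ?codE //.
  by rewrite (proj1 pa) size_nseq.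
by apply: seq_ob_eq; rewrite size_map size_nseq.
Qed.

(** B is a threefold abstraction, so beta exposes an abstraction after zero, one or two arguments.
    Substitution then extends eta to B f and B f g for arbitrary [f] and [g]. *)
Lemma functional_saturate_B :
  [/\ functional lam_B, functional (lam_B · one)
    & functional (lam_B · one · one)].
Proof.
have d3 : size (dom (one · bul)) = 3.
  by rewrite size_dom_app dom_id; case: bulP => -> _.
have n3 : dom (one · bul) <> [::] by move=> e; rewrite e in d3.
have d2 : size (dom (lam (one · bul))) = 2.
  by move: (dom_lam n3); rewrite d3 => -[].
have n2 : dom (lam (one · bul)) <> [::] by move=> e; rewrite e in d2.
have d1 : size (dom (lam (lam (one · bul)))) = 1.
  by move: (dom_lam n2); rewrite d2 => -[].
have n1 : dom (lam (lam (one · bul))) <> [::] by move=> e; rewrite e in d1.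
split; rewrite ?/lam_B; do ?rewrite lam_app //; exact: functional_lam.
Qed.

Lemma functional_B : functional lam_B.
Proof. by case: functional_saturate_B. Qed.

Lemma functional_B1 f : functional (lam_B · f).
Proof.
case: functional_saturate_B => _ h _.
exact: (functional_app_seq (gs := [:: f]) (point_B lam_combinators) h).
Qed.

Lemma functional_B2 f g : functional (lam_B · f · g).
Proof.
case: functional_saturate_B => _ _ h.
exact: (functional_app_seq (gs := [:: f; g]) (point_B lam_combinators) h).
Qed.

Lemma functional_I : functional lam_I.
Proof. by apply: functional_lam; rewrite dom_id. Qed.

Lemma functional_dot a : functional (lam_dot a).
Proof.
apply: functional_lam => /(congr1 size).
by rewrite size_dom_app dom_id.
Qed.

Ltac fext := apply: functional_ext;
  [ by auto using functional_B, functional_B1, functional_B2,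
      functional_I, functional_dot
  | by auto using functional_B, functional_B1, functional_B2,
      functional_I, functional_dot
  | ].

(** Each [fext] supplies a fresh last variable, so the occurrences of [one] are distinct variables
    read from left to right. Only closed terms are moved by [app_dot'], hence this order is
    preserved. *)
Lemma axioms_ev : planar_lambda_axioms star bul lam_B lam_I lam_dot.
Proof.
have pB := point_B lam_combinators; have pI := point_I lam_combinators.
have pd a : point star a -> point star (lam_dot a).
  exact: point_dot lam_combinators a.
split; [|split; [|split; [|split; [|split; [|split]]]]].
- fext; rewrite !appB'; fext; rewrite !appB'; fext.
  by rewrite !appB' appI'.
- by fext; rewrite !appB' !appI'.
- by move=> a pa; fext; rewrite !appB' !appI'.
- fext; rewrite !appB' app_dot' //; fext; rewrite !appB'; fext.
  by rewrite !appB'; fext; rewrite !appB'.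
- by fext; rewrite !appB' app_dot' //; fext; rewrite !appB' !appI'.
- move=> a pa; fext; rewrite !appB' app_dot' ?pd //; auto.
  by fext; rewrite !appB' !app_dot'.
- move=> a b pa pb; fext; rewrite !appB' !app_dot' ?appB' //.
  exact: point_app.
Qed.

Lemma wme_ev : weakly_multi_extensional star bul lam_B lam_I.
Proof.
move=> n a b pa pb; rewrite !(polyE bulP) ?codE //.
rewrite (star_power_app bulP lam_combinators _ (codE lam_I)).
rewrite -/(lift_id bul lam_B lam_I n).
(* The induction passes from [a] to the open term [a · one], so closedness has to be dropped
   first. *)
elim: n a b {pa pb} => [|n IH] a b; first by rewrite /= !appI'.
rewrite /saturate !iterSr => /IH e.
rewrite -[lift_id _ _ _ _]/(lam_B · lift_id bul lam_B lam_I n).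
by fext; rewrite !appB'.
Qed.

Lemma planar_lambda_model_ev : planar_lambda_model star bul.
Proof.
split; last first.
  exists lam_B, lam_I, lam_dot.
  by split; [exact: lam_combinators | exact: axioms_ev | exact: wme_ev].
split; first exact: bulP.
- have := computable_ev (one · bul).
  by rewrite size_dom_app dom_id; case: bulP => -> _.
- by have := computable_ev one; rewrite dom_id.
- move=> a [da ca]; have := computable_ev (one · a).
  by rewrite size_dom_app dom_id da.
Qed.

End Abstraction.

Lemma operad_is_computable f : exists n, computable star bul n f.
Proof.
have [lam [dl la lc]] := ev_abstraction.
by exists (size (dom f)); exact: computable_ev dl la f.
Qed.

Lemma operad_planar_lambda_model : planar_lambda_model star bul.
Proof.
have [lam [dl la lc]] := ev_abstraction; exact: planar_lambda_model_ev dl la lc.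
Qed.

End SemiClosedOperad.

(** * The adjunction, its invertible unit, and full faithfulness *)

Lemma L_well_definedP : L_well_defined.
Proof. exact: operad_planar_lambda_model. Qed.

Lemma R_well_definedP : R_well_defined.
Proof.
exists R_closedP => T; have [_ [B [I [dot [ch ax wme]]]]] := st_model T.
exact: R_semi_closed ch ax wme.
Qed.

Section Adjunction.
Variables (hL : L_well_defined) (hR : R_well_defined).
Local Notation L := (L_s hL).
Local Notation R := (R_s hR).

Definition unit_fun (O : O_s) (f : mor O) : R_morphism (L_ob hL O) :=
  exist _ f (operad_is_computable f).

#[local] Obligation Tactic := idtac.

Program Definition unit_mor (O : O_s) : @Hom O_s O (R (L O)) :=
  @ClosedFunctor O (R_ob hR (L_ob hL O))
    (@MFunctor O (R_ob hR (L_ob hL O)) (fun _ => tt) (@unit_fun O) _ _ _ _) _.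
Next Obligation.
by move=> O f; rewrite /= /R_dom /=; elim: (dom f) => //= x s ->.
Qed.
Next Obligation. by []. Qed.
Next Obligation.
by move=> O A; apply: R_morphism_eq; rewrite /= (star_unique A).
Qed.
Next Obligation.
move=> O f gs e; apply: R_morphism_eq; apply/esym.
rewrite [LHS]sval_R_comp; first by rewrite -map_comp map_id.
by rewrite /R_dom /= -e -map_comp size_map; elim: gs {e} => //= g gs ->.
Qed.
Next Obligation.
move=> O A B'; split=> //; apply: R_morphism_eq.
by rewrite /= (star_unique A) (star_unique B').
Qed.

Program Definition inclusion (T : T_s) : mfunctor (R_ob hR T) (st_mcat T) :=
  @MFunctor (R_ob hR T) (st_mcat T) (fun _ => st_ob T) sval _ _ _ _.
Next Obligation.
by move=> T f; rewrite dom_computable /= /R_dom map_nseq.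
Qed.
Next Obligation. by move=> T f; exact: cod_computable. Qed.
Next Obligation. by []. Qed.
Next Obligation. by move=> T f gs e; exact: sval_R_comp. Qed.

Definition counit_mor (T : T_s) : @Hom T_s (L (R T)) T :=
  @SMorphism (L_ob hL (R_ob hR T)) T (inclusion T) erefl erefl.

(** Makes the functor underlying the counit at L O a morphism of operads, which serves as the
    inverse of the unit. *)
Lemma inclusion_closed (O : O_s) :
  @is_closed (R_ob hR (L_ob hL O)) O (inclusion (L O)).
Proof.
by move=> x y; split=> /=; first exact: esym (star_unique _).
Qed.

Definition unit_inv (O : O_s) : @Hom O_s (R (L O)) O :=
  @ClosedFunctor (R_ob hR (L_ob hL O)) O _ (inclusion_closed (O := O)).

Program Definition LR_adjunction : adjunction L R :=
  @Adjunction _ _ L R unit_mor counit_mor _ _ _ _.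
Next Obligation.
by move=> O O' F; apply: closed_functor_eq => // f; apply: R_morphism_eq.
Qed.
Next Obligation.
by move=> T T' F; apply: s_morphism_eq => // x; rewrite /= sm_ob.
Qed.
Next Obligation.
by move=> O; apply: s_morphism_eq => // x; exact: esym (star_unique _).
Qed.
Next Obligation.
move=> T; apply: closed_functor_eq => [[]//|f]; exact: R_morphism_eq.
Qed.

Lemma unit_iso (O : O_s) : is_iso (unit_mor O).
Proof.
exists (unit_inv O); split; apply: closed_functor_eq.
- by move=> x; exact: esym (star_unique _).
- by [].
- by case.
- by move=> f; exact: R_morphism_eq.
Qed.

(** This is fullness of L: with one object the condition on internal homs is automatic, and
    preserving the application is preserving [ev]. *)
Lemma s_morphism_closed (O O' : O_s) (F : @Hom T_s (L O) (L O')) :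
  @is_closed O O' F.
Proof.
move=> x y; rewrite [LHS]star_unique (star_unique x) (star_unique y).
split; first exact: esym (star_unique _).
by rewrite (sm_bul F) (star_unique (mf_ob F star)).
Qed.

Lemma L_fully_faithful : fully_faithful L.
Proof.
move=> O O'; exists (fun F : @Hom T_s (L O) (L O') =>
  @ClosedFunctor O O' (sm_mfun F) (s_morphism_closed F)) => F.
  exact: closed_functor_eq.
exact: s_morphism_eq.
Qed.

End Adjunction.

Theorem theorem2 :
  exists (hL : L_well_defined) (hR : R_well_defined)
         (adj : adjunction (L_s hL) (R_s hR)),
    (forall M : O_s, is_iso (adj_unit adj M)) /\
    fully_faithful (L_s hL).
Proof.
exists L_well_definedP, R_well_definedP, (LR_adjunction _ _).
by split; [exact: unit_iso | exact: L_fully_faithful].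
Qed.
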